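(* Let $a\in\mathbb{Z}_{\ge0}^n$ be a weak composition all of whose nonzero entries are equal (equivalently, sorting $a$ into a partition gives a rectangle $s^r$). Then $$L_a(\mathbf{x};\beta)=\sum_{D\in\mathcal{D}_a}\mathrm{wt}_\beta(D).$$
   Context: Lascoux polynomials: $S_n$ is generated by simple transpositions $s_1,\dots,s_{n-1}$ and acts on $\mathbb{Z}^n$ by $(wa)_j=a_{w^{-1}(j)}$. On $\mathbb{Z}[\beta][x_1,\dots,x_n]$ define $\pi_if=\frac{x_if-x_{i+1}\,s_if}{x_i-x_{i+1}}$ ($s_i$ swapping $x_i,x_{i+1}$) and $\varpi_if=\pi_i((1+\beta x_{i+1})f)$; they satisfy the braid relations, so $\varpi_w:=\varpi_{i_1}\cdots\varpi_{i_\ell}$ for any reduced expression $w=s_{i_1}\cdots s_{i_\ell}$ is well defined. For $a\in\mathbb{Z}^n_{\ge0}$ with sorted partition $\mu$ and $w$ the minimal-length coset representative in $S_n/\mathrm{Stab}(\mu)$ with $w\mu=a$, set $L_a(\mathbf{x};\beta)=\varpi_w x_1^{\mu_1}\cdots x_n^{\mu_n}$. K-Kohnert diagrams: a K-Kohnert diagram is a finite set $D$ of boxes at positions $(x,y)$ with $x\in\{1,\dots,n\}$ (column) and $y\ge1$ (row), together with a subset $M\subseteq D$ of marked boxes. The initial (skyline) diagram of $a$ is $D=\{(i,y):1\le i\le n,\ 1\le y\le a_i\}$ with $M=\emptyset$. A Kohnert move: choose a column $x$ whose topmost box $(x,y)$ of $D$ (largest $y$) is unmarked; let $x'$ be the largest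 integer $<x$ with $(x',y)\notin D$; require $x'\ge1$ and that no box $(x'',y)$ with $x'<x''<x$ is marked; then move the box from $(x,y)$ to $(x',y)$ (unmarked). A K-Kohnert move is the same, except that the box at $(x,y)$ is left behind as a marked box while a new unmarked box is placed at $(x',y)$. $\mathcal{D}_a$ is the set of K-Kohnert diagrams obtainable from the initial diagram of $a$ by finite sequences of Kohnert and K-Kohnert moves. The $\beta$-weight is $\mathrm{wt}_\beta(D)=\beta^{|M|}\prod_{i=1}^nx_i^{c_i}$, where $c_i$ is the number of boxes (marked or unmarked) of $D$ in column $i$. *)

(* Defs.v *)
From HB Require Import structures.
From mathcomp Require Import all_boot all_order all_fingroup all_algebra.
From mathcomp Require Import mpoly.

Set Implicit Arguments.
Unset Strict Implicit.
Unset Printing Implicit Defensive.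

Import GRing.Theory.

(* Indices are 0-based: an index i : 'I_n.-1 names the adjacent pair of
   positions lo i = i and hi i = i + 1 in 'I_n. *)

Definition lo (n : nat) (i : 'I_n.-1) : 'I_n := widen_ord (leq_pred n) i.

Lemma hi_subproof (n : nat) (i : 'I_n.-1) : i.+1 < n.
Proof. by case: n i => [|n] [i]. Qed.

Definition hi (n : nat) (i : 'I_n.-1) : 'I_n := Ordinal (hi_subproof i).

Definition simple_tr (n : nat) (i : 'I_n.-1) : 'S_n := tperm (lo i) (hi i).

(* The composite s_{i_1} o ... o s_{i_l} for u = [:: i_1; ...; i_l].  The group
   law of 'S_n is composition in the opposite order, (s * t) x = t (s x), so
   s_i o w is written w * s_i. *)
Definition word_perm (n : nat) (u : seq 'I_n.-1) : 'S_n :=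
  foldr (fun i (w : 'S_n) => (w * simple_tr i)%g) 1%g u.

Lemma word_perm_cat (n : nat) (u v : seq 'I_n.-1) :
  word_perm (u ++ v) = (word_perm v * word_perm u)%g.
Proof. by elim: u => [|i u IH] /=; rewrite ?mulg1 // IH mulgA. Qed.

Lemma word_perm_tperm (n d : nat) (x y : 'I_n) : y = x + d.+1 :> nat ->
  exists u : seq 'I_n.-1, word_perm u = tperm x y.
Proof.
elim: d y => [|d IH] y yE.
  have lt_x : x < n.-1.
    by have := ltn_ord y; rewrite yE addn1 => lt_n; rewrite -ltnS (ltn_predK lt_n).
  exists [:: Ordinal lt_x]; rewrite /= mul1g /simple_tr.
  by congr tperm; apply: val_inj; rewrite //= yE addn1.
have lt_z : x + d.+1 < n by have := ltn_ord y; rewrite yE addnS; exact: ltnW.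
pose z := Ordinal lt_z.
have lt_z' : z < n.-1.
  by have := ltn_ord y; rewrite yE addnS => lt_n; rewrite -ltnS (ltn_predK lt_n).
have [u uE] := IH z erefl.
exists (u ++ [:: Ordinal lt_z'] ++ u).
rewrite !word_perm_cat uE /= mul1g /simple_tr.
have -> : lo (Ordinal lt_z') = z by apply: val_inj.
have -> : hi (Ordinal lt_z') = y by apply: val_inj; rewrite /= yE !addnS.
have -> : (tperm x z * tperm z y * tperm x z = tperm z y ^ tperm x z)%g.
  by rewrite /conjg tpermV mulgA.
have lt_zy : z < y by rewrite yE /= !addnS.
have lt_xz : x < z by rewrite /= addnS ltnS leq_addr.
have neq_xy : x != y by rewrite -val_eqE neq_ltn /= (ltn_trans lt_xz lt_zy).
have neq_zy : z != y by rewrite -val_eqE neq_ltn /= lt_zy.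
by rewrite tpermJ tpermR tpermD.
Qed.

Lemma word_perm_surj (n : nat) (w : 'S_n) :
  exists u : seq 'I_n.-1, word_perm u = w.
Proof.
have [ts -> _] := prod_tpermP w.
elim: ts => [|[x y] ts [u uE]]; first by exists [::]; rewrite big_nil.
have [v vE] : exists v : seq 'I_n.-1, word_perm v = tperm x y.
  case: (ltngtP x y) => [lt_xy|lt_yx|/val_inj ->].
  - by apply: (@word_perm_tperm n (y - x.+1)); rewrite -addSnnS subnKC.
  - rewrite tpermC.
    by apply: (@word_perm_tperm n (x - y.+1)); rewrite -addSnnS subnKC.
  - by exists [::]; rewrite tperm1.
by exists (u ++ v); rewrite word_perm_cat vE uE big_cons.
Qed.

Lemma perm_len_subproof (n : nat) (w : 'S_n) :
  exists k, [exists u : k.-tuple 'I_n.-1, word_perm u == w].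
Proof.
have [u uE] := word_perm_surj w.
by exists (size u); apply/existsP; exists (in_tuple u); apply/eqP.
Qed.

Definition perm_len (n : nat) (w : 'S_n) : nat := ex_minn (perm_len_subproof w).

Definition reduced_expr (n : nat) (u : seq 'I_n.-1) (w : 'S_n) : bool :=
  (word_perm u == w) && (size u == perm_len w).

Lemma reduced_word_subproof (n : nat) (w : 'S_n) :
  exists u : seq 'I_n.-1, reduced_expr u w.
Proof.
rewrite /reduced_expr /perm_len; case: ex_minnP => k /existsP[u uE] _.
by exists u; rewrite uE size_tuple eqxx.
Qed.

Definition reduced_word (n : nat) (w : 'S_n) : seq 'I_n.-1 :=
  xchoose (reduced_word_subproof w).

Definition perm_act (n : nat) (w : 'S_n) (a : n.-tuple nat) : n.-tuple nat :=
  [tuple tnth a ((w^-1)%g j) | j < n].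

Definition sorted_part (n : nat) (a : n.-tuple nat) : n.-tuple nat :=
  [tuple of sort geq a].

Lemma sorting_perm_subproof (n : nat) (a : n.-tuple nat) :
  exists w : 'S_n, perm_act w (sorted_part a) == a.
Proof.
have /tuple_permP[p pE] : perm_eq a (sorted_part a) by rewrite perm_sym perm_sort.
exists (p^-1)%g; apply/eqP/val_inj; apply: (etrans _ (esym pE)).
by congr (tval _); apply: eq_mktuple => j; rewrite invgK.
Qed.

Definition min_coset_rep (n : nat) (a : n.-tuple nat) : 'S_n :=
  [arg min_(w < xchoose (sorting_perm_subproof a)
              | perm_act w (sorted_part a) == a) perm_len w].

Local Open Scope ring_scope.

(* Z[beta][x_1, ..., x_n]; the polynomial variable of {poly int} is beta. *)
Notation betapoly n := {mpoly {poly int}[n]}.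

Definition beta (n : nat) : betapoly n := ('X : {poly int})%:MP.

Definition swap_vars (n : nat) (i : 'I_n.-1) (f : betapoly n) : betapoly n :=
  msym (simple_tr i) f.

Lemma swap_vars_dvd (n : nat) (i : 'I_n.-1) (f : betapoly n) :
  exists g : betapoly n, ('X_(lo i) - 'X_(hi i)) * g = f - swap_vars i f.
Proof.
pose P (f : betapoly n) :=
  exists g : betapoly n, ('X_(lo i) - 'X_(hi i)) * g = f - swap_vars i f.
have PD f1 f2 : P f1 -> P f2 -> P (f1 + f2).
  move=> [g1 e1] [g2 e2]; exists (g1 + g2).
  by rewrite mulrDr e1 e2 /swap_vars msymD opprD addrACA.
have PM f1 f2 : P f1 -> P f2 -> P (f1 * f2).
  move=> [g1 e1] [g2 e2]; exists (g1 * f2 + swap_vars i f1 * g2).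
  rewrite mulrDr mulrA e1 mulrCA e2 /swap_vars msymM mulrBl mulrBr addrA.
  by rewrite subrK.
have P1 : P 1 by exists 0; rewrite mulr0 /swap_vars msym1 subrr.
have PZ c f1 : P f1 -> P (c *: f1).
  move=> [g1 e1]; exists (c *: g1).
  by rewrite -scalerAr e1 /swap_vars msymZ scalerBr.
have PX j : P 'X_j.
  rewrite /P /swap_vars /msym mmapX mmap1U /simple_tr.
  case: tpermP => [->|->|_ _]; [exists 1 | exists (-1) | exists 0].
  - by rewrite mulr1.
  - by rewrite mulrN1 opprB.
  - by rewrite mulr0 subrr.
elim/mpolyind: f => [|c m p _ _ Pp].
  by exists 0; rewrite mulr0 /swap_vars msym0 subrr.
apply: (PD) Pp; apply: PZ; rewrite mpolyXE_id.
apply: (big_ind P) => // j _.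
by elim: (m j) => [|k Pk]; rewrite ?expr0 ?exprS //; apply: PM.
Qed.

Lemma pi_op_subproof (n : nat) (i : 'I_n.-1) (f : betapoly n) :
  exists g : betapoly n, ('X_(lo i) - 'X_(hi i)) * g
    == 'X_(lo i) * f - 'X_(hi i) * swap_vars i f.
Proof.
have [g gE] := swap_vars_dvd i f; exists (f + 'X_(hi i) * g).
by rewrite mulrDr mulrCA gE mulrBl mulrBr addrA subrK.
Qed.

(* The quotient (x_i f - x_{i+1} s_i f) / (x_i - x_{i+1}), which is unique since
   betapoly n is an integral domain. *)
Definition pi_op (n : nat) (i : 'I_n.-1) (f : betapoly n) : betapoly n :=
  xchoose (pi_op_subproof i f).

Definition varpi_op (n : nat) (i : 'I_n.-1) (f : betapoly n) : betapoly n :=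
  pi_op i ((1 + beta n * 'X_(hi i)) * f).

(* varpi_{i_1} (... (varpi_{i_l} f)) for u = [:: i_1; ...; i_l]. *)
Definition varpi_word (n : nat) (u : seq 'I_n.-1) (f : betapoly n) : betapoly n :=
  foldr (@varpi_op n) f u.

(* The operators varpi_i satisfy the braid relations, so the choice of the
   reduced expression of w is immaterial. *)
Definition varpi_perm (n : nat) (w : 'S_n) (f : betapoly n) : betapoly n :=
  varpi_word (reduced_word w) f.

Definition lascoux (n : nat) (a : n.-tuple nat) : betapoly n :=
  varpi_perm (min_coset_rep a) (\prod_(i < n) 'X_i ^+ tnth (sorted_part a) i).

Local Close Scope ring_scope.

(* The box (x, y) : 'I_n * 'I_m stands for the position in column x + 1 and
   row y + 1. *)
Notation box n m := ('I_n * 'I_m)%type.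

(* The pair (D, M) of a set of boxes and its subset of marked boxes. *)
Definition diagram (n m : nat) :=
  {DM : {set box n m} * {set box n m} | DM.2 \subset DM.1}.

Definition boxes (n m : nat) (D : diagram n m) : {set box n m} := (val D).1.

Definition marks (n m : nat) (D : diagram n m) : {set box n m} := (val D).2.

Definition movable (n m : nat) (D : diagram n m) (x x' : 'I_n) (y : 'I_m) : bool :=
  [&& (x, y) \in boxes D,
      [forall y' : 'I_m, ((x, y') \in boxes D) ==> (y' <= y)],
      (x, y) \notin marks D,
      x' < x,
      (x', y) \notin boxes D,
      [forall x'' : 'I_n, (x' < x'' < x) ==> ((x'', y) \in boxes D)] &
      [forall x'' : 'I_n, (x' < x'' < x) ==> ((x'', y) \notin marks D)]].

Definition kohnert_move (n m : nat) (D D' : diagram n m) : bool :=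
  [exists x : 'I_n, exists x' : 'I_n, exists y : 'I_m,
    [&& movable D x x' y,
        boxes D' == (x', y) |: (boxes D :\ (x, y)) &
        marks D' == marks D]].

Definition K_kohnert_move (n m : nat) (D D' : diagram n m) : bool :=
  [exists x : 'I_n, exists x' : 'I_n, exists y : 'I_m,
    [&& movable D x x' y,
        boxes D' == (x', y) |: boxes D &
        marks D' == (x, y) |: marks D]].

Definition any_move (n m : nat) : rel (diagram n m) :=
  fun D D' => kohnert_move D D' || K_kohnert_move D D'.

(* Moves never change the row of a box, so every diagram obtainable from the
   skyline diagram of a has all its boxes in the first height a rows. *)
Definition height (n : nat) (a : n.-tuple nat) : nat := \max_(i < n) tnth a i.

Definition skyline (n : nat) (a : n.-tuple nat) : diagram n (height a) :=
  exist _ ([set b : box n (height a) | b.2 < tnth a b.1], set0) (sub0set _).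

Definition KKD (n : nat) (a : n.-tuple nat) : {set diagram n (height a)} :=
  [set D | connect (@any_move n (height a)) (skyline a) D].

Definition col_count (n m : nat) (D : diagram n m) (i : 'I_n) : nat :=
  #|[set b in boxes D | b.1 == i]|.

Local Open Scope ring_scope.

Definition wt_beta (n m : nat) (D : diagram n m) : betapoly n :=
  beta n ^+ #|marks D| * \prod_(i < n) 'X_i ^+ col_count D i.

(* Main.v *)
(* Read each row of a diagram as a word in three letters (empty, unmarked,
   marked).  The diagrams reachable from columns of equal height s supported on
   f are exactly those in which every row is "flagged" by the set U of unmarked
   positions of the row below it (by f for the bottom row): it has as many
   unmarked boxes, and each occupied position x satisfies
   #{u in U, u < x} < #{unmarked positions <= x}.  These are the set-valued
   tableaux of shape s^r with row bounds f.  Hence the generating function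
   obeys  G_s(f) = sum over rows c flagged by f of wt(c) G_(s-1)(U(c)).
   From this recursion, by induction on s, varpi_i G_s(f) = G_s(s_i f) when
   i is in f and i + 1 is not, and varpi_i G_s(f) = G_s(f) otherwise: fixing a
   row outside the columns i, i + 1 leaves a sum of at most four terms.  For an
   initial segment f only one diagram is flagged, which gives the monomial
   x^mu, and a minimal word for w raises the sum of the elements of f by one at
   each letter, so no letter acts trivially. *)
Require Import Defs.
From mathcomp Require Import all_boot all_order all_fingroup all_algebra.
From mathcomp Require Import mpoly.
From mathcomp Require Import zify ring.

Set Implicit Arguments.
Unset Strict Implicit.
Unset Printing Implicit Defensive.

Import GRing.Theory.

(** * Counting functions of subsets, dominance, and flagged rows *)

Definition cnt (n : nat) (f : {set 'I_n}) (k : nat) : nat :=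
  \sum_(x in f) (x < k).

Lemma cntS (n : nat) (f : {set 'I_n}) (x : 'I_n) :
  cnt f x.+1 = (x \in f) + cnt f x.
Proof.
rewrite /cnt; case: (boolP (x \in f)) => xf.
  rewrite !(big_setD1 x xf) /= ltnSn ltnn add0n; congr (_ + _).
  by apply: eq_bigr => z; rewrite !inE -val_eqE /= => /andP[zx _]; lia.
apply: eq_bigr => z zf.
have : z != x by apply: contraNneq xf => <-.
by rewrite -val_eqE /=; lia.
Qed.

Lemma cnt_mono (n : nat) (f : {set 'I_n}) (k l : nat) :
  k <= l -> cnt f k <= cnt f l.
Proof. by move=> kl; apply: leq_sum => x _; lia. Qed.

Lemma cnt_all (n : nat) (f : {set 'I_n}) : cnt f n = #|f|.
Proof. by rewrite -sum1_card; apply: eq_bigr => x _; rewrite ltn_ord. Qed.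

Lemma cntU1 (n : nat) (f : {set 'I_n}) (x : 'I_n) (k : nat) :
  x \notin f -> cnt (x |: f) k = (x < k) + cnt f k.
Proof. by move=> xf; rewrite /cnt big_setU1. Qed.

Lemma cntD1 (n : nat) (f : {set 'I_n}) (x : 'I_n) (k : nat) :
  x \in f -> cnt f k = (x < k) + cnt (f :\ x) k.
Proof. by move=> xf; rewrite /cnt (big_setD1 x xf). Qed.

(** Descend from [n], where the cardinalities give equality. At a position of [g] the hypothesis is
    the bound itself; at any other position [cnt g] stays constant while [cnt f] can only drop. *)
Lemma cnt_dom (n : nat) (f g : {set 'I_n}) (u k : nat) :
    #|g| + u = #|f| -> k <= n ->
    (forall x : 'I_n, x \in g -> k <= x -> cnt f x < cnt g x.+1 + u) ->
  cnt f k <= cnt g k + u.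
Proof.
move=> gf; move dE: (n - k) => d; elim: d k dE => [|d IH] k dE kn gP.
  have -> : k = n by lia.
  by rewrite !cnt_all gf.
have lt_kn : k < n by lia.
have IHk : cnt f k.+1 <= cnt g k.+1 + u.
  by apply: IH => [||x xg kx]; [lia | lia | apply: gP => //; lia].
have := cntS g (Ordinal lt_kn); have := cntS f (Ordinal lt_kn).
have := gP (Ordinal lt_kn); rewrite /=.
case: (Ordinal lt_kn \in g) => gk fS gS; last by lia.
by have := gk isT (leqnn _); lia.
Qed.

(* None: empty position; Some b: a box, marked when b = true. *)
Definition rowcfg (n : nat) := {ffun 'I_n -> option bool}.

Definition unm (n : nat) (c : rowcfg n) : {set 'I_n} :=
  [set x | c x == Some false].

Definition flagged (n : nat) (f : {set 'I_n}) (c : rowcfg n) : bool :=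
  (#|unm c| == #|f|)
  && [forall x, (c x != None) ==> (cnt f x < cnt (unm c) x.+1)].

Lemma cnt_gap (n : nat) (f : {set 'I_n}) (k l : nat) : k <= l ->
  (forall x : 'I_n, k <= x < l -> x \notin f) -> cnt f l = cnt f k.
Proof.
move=> kl fP; apply: eq_bigr => x xf; congr nat_of_bool.
case: (ltnP x k) => [xk|kx]; first by rewrite (leq_trans xk).
by apply/negP => xl; have := fP x; rewrite kx xl xf => /(_ isT).
Qed.

Lemma cnt_run (n : nat) (f : {set 'I_n}) (k l : nat) : k <= l -> l <= n ->
  (forall x : 'I_n, k <= x < l -> x \in f) -> cnt f l = cnt f k + (l - k).
Proof.
elim: l => [|l IH] kl ln fP; first by rewrite (_ : k = 0) ?addn0 //; lia.
have [kl'|lk] := leqP k l; last by rewrite (_ : k = l.+1) ?subnn ?addn0 //; lia.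
have := cntS f (Ordinal ln); rewrite /= => ->.
rewrite fP /= ?kl' ?ltnSn // IH //; [lia | lia |].
by move=> x /andP[kx xl]; apply: fP; rewrite kx ltnW.
Qed.

Lemma cnt_slope (n : nat) (f : {set 'I_n}) (k l : nat) : k <= l -> l <= n ->
  cnt f l <= cnt f k + (l - k).
Proof.
elim: l => [|l IH] kl ln; first by rewrite (_ : k = 0) ?addn0 //; lia.
have [kl'|lk] := leqP k l; last by rewrite (_ : k = l.+1) ?subnn ?addn0 //; lia.
have := cntS f (Ordinal ln); rewrite /= => ->.
by have := IH kl' (ltnW ln); case: (_ \in f) => /=; lia.
Qed.

Lemma cnt_eq_above (n : nat) (f g : {set 'I_n}) (k : nat) : #|g| = #|f| ->
  (forall x : 'I_n, k <= x -> (x \in g) = (x \in f)) -> cnt g k = cnt f k.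
Proof.
have split_card (h : {set 'I_n}) : #|h| = cnt h k + \sum_(x in h) (k <= x).
  rewrite -cnt_all -big_split; apply: eq_bigr => x _ /=.
  by rewrite ltn_ord; case: ltnP.
move=> gf fgP; have := gf; rewrite !split_card.
suff -> : \sum_(x in g) (k <= x) = \sum_(x in f) (k <= x) by move/addIn.
rewrite big_mkcond [RHS]big_mkcond; apply: eq_bigr => x _ /=.
by case: leqP => [/fgP ->|_] //; do 2!case: ifP.
Qed.

Lemma cnt_exchange (n : nat) (f : {set 'I_n}) (x y : 'I_n) (k : nat) :
  x \in f -> y \notin f -> cnt (y |: (f :\ x)) k + (x < k) = cnt f k + (y < k).
Proof.
move=> xf yf; rewrite cntU1 ?(cntD1 k xf); first by rewrite addnC addnA addnAC.
by rewrite !inE negb_and yf orbT.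
Qed.

Lemma card_exchange (n : nat) (f : {set 'I_n}) (x y : 'I_n) :
  x \in f -> y \notin f -> #|y |: (f :\ x)| = #|f|.
Proof.
move=> xf yf; rewrite cardsU1 (cardsD1 x f) xf !inE negb_and yf.
by rewrite orbT.
Qed.

Definition full_row (n : nat) (f : {set 'I_n}) : rowcfg n :=
  [ffun x => if x \in f then Some false else None].

Lemma unm_full_row (n : nat) (f : {set 'I_n}) : unm (full_row f) = f.
Proof. by apply/setP => x; rewrite inE ffunE; case: ifP. Qed.

Definition flag_rel (n : nat) : rel (rowcfg n) :=
  fun c d => flagged (unm c) d.

(** * Diagrams whose rows form a flagged chain, and their stability under moves *)

Section Diagrams.
Variables (n m : nat) (f : {set 'I_n}).
Implicit Types (D : diagram n m) (x : 'I_n) (y z : 'I_m).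

Definition diag_row D y : rowcfg n :=
  [ffun x => if (x, y) \in boxes D then Some ((x, y) \in marks D) else None].

Definition unmarked D y : {set 'I_n} :=
  [set x | ((x, y) \in boxes D) && ((x, y) \notin marks D)].

Definition rows D : m.-tuple (rowcfg n) := [tuple diag_row D y | y < m].

(* The row under row 0 is taken to be f itself. *)
Definition below D y : {set 'I_n} :=
  unm (nth (full_row f) (full_row f :: rows D) y).

Definition valid D : bool := path (@flag_rel n) (full_row f) (rows D).

Lemma unm_diag_row D y : unm (diag_row D y) = unmarked D y.
Proof.
by apply/setP => x; rewrite !inE ffunE; do 2!case: (_ \in _).
Qed.

Lemma nth_rows D y : nth (full_row f) (rows D) y = diag_row D y.
Proof. by rewrite -tnth_nth tnth_mktuple. Qed.

Lemma below0 D y : y = 0 :> nat -> below D y = f.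
Proof. by rewrite /below => -> /=; rewrite unm_full_row. Qed.

Lemma belowS D y z : z = y.+1 :> nat -> below D z = unmarked D y.
Proof. by rewrite /below => -> /=; rewrite nth_rows unm_diag_row. Qed.

Lemma validP D : reflect
  (forall y, #|unmarked D y| = #|below D y| /\
    forall x, (x, y) \in boxes D -> cnt (below D y) x < cnt (unmarked D y) x.+1)
  (valid D).
Proof.
apply: (iffP (pathP (full_row f))); rewrite size_tuple => H.
  move=> y; have := H y (ltn_ord y); rewrite /flag_rel nth_rows.
  move=> /andP[/eqP cy /forallP fy]; rewrite -unm_diag_row; split=> // x xy.
  by have := fy x; rewrite ffunE xy.
move=> k km; have := H (Ordinal km); rewrite /below /= => -[cy fy].
have -> : nth (full_row f) (rows D) k = diag_row D (Ordinal km).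
  by rewrite -(nth_rows D (Ordinal km)).
rewrite /flag_rel /flagged unm_diag_row cy eqxx; apply/forallP => x.
by apply/implyP; rewrite ffunE; case: ifP => // xk _; apply: fy.
Qed.

Lemma unmarked_box D x y : x \in unmarked D y -> (x, y) \in boxes D.
Proof. by rewrite inE => /andP[]. Qed.

Section ValidDiagram.
Variable D : diagram n m.
Hypothesis vD : valid D.

Lemma valid_card y : #|unmarked D y| = #|f|.
Proof.
case: y => y; elim: y => [|y IH] ym.
  by have [-> _] := validP _ vD (Ordinal ym); rewrite below0.
have [-> _] := validP _ vD (Ordinal ym).
by rewrite (@belowS D (Ordinal (ltnW ym))).
Qed.

(** The flag condition at the unmarked boxes is the hypothesis of [cnt_dom] with [u = 0]. *)
Lemma below_dom y k : k <= n -> cnt (below D y) k <= cnt (unmarked D y) k.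
Proof.
move=> kn; have [cy fy] := validP _ vD y.
rewrite -[leqRHS]addn0; apply: cnt_dom => // [|x xu _]; rewrite addn0 //.
exact/fy/unmarked_box.
Qed.

Lemma unmarked_dom y z k : y < z -> k <= n ->
  cnt (unmarked D y) k <= cnt (below D z) k.
Proof.
case: z => z; elim: z => // z IH zm yz kn.
rewrite (@belowS D (Ordinal (ltnW zm))) //.
move: yz; rewrite /= ltnS leq_eqVlt => /orP[/eqP yz|yz].
  by rewrite (_ : y = Ordinal (ltnW zm)) //; apply: val_inj.
exact: leq_trans (IH (ltnW zm) yz kn) (below_dom _ kn).
Qed.

Lemma flag_dom y k : k <= n -> cnt f k <= cnt (below D y) k.
Proof.
move=> kn; case: y => y; elim: y => [|y IH] ym; first by rewrite below0.
rewrite (@belowS D (Ordinal (ltnW ym))) //.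
exact: leq_trans (IH (ltnW ym)) (below_dom _ kn).
Qed.

End ValidDiagram.

Lemma below_eq D D' y z :
  (forall y', y' != y -> unmarked D' y' = unmarked D y') ->
  z != y.+1 :> nat -> below D' z = below D z.
Proof.
move=> eqU zy; case: z zy => [[|z] zm] zy; first by rewrite !below0.
rewrite !(@belowS _ (Ordinal (ltnW zm))) //; apply: eqU.
by apply: contraNneq zy => <-.
Qed.

(** Both kinds of move exchange [x] for [x'] among the unmarked positions of row [y] and create no
    box besides [(x', y)]. Row [y] itself only gains from the shift to the left; the delicate row is
    the one above it, whose flag has moved left. *)
Lemma valid_step D D' x x' y : valid D -> movable D x x' y ->
  unmarked D' y = x' |: (unmarked D y :\ x) ->
  (forall z, z != y -> unmarked D' z = unmarked D z) ->
  (forall b, b \in boxes D' -> b = (x', y) \/ b \in boxes D) ->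
  valid D'.
Proof.
move=> vD /and5P[xy /forallP top xnm x'x /and3P[x'y /forallP btw /forallP btwm]].
move=> U'E U'z bD'.
set U := unmarked D y in U'E *.
have xU : x \in U by rewrite inE xy.
have x'U : x' \notin U by rewrite inE (negbTE x'y).
have cntU' k := cnt_exchange k xU x'U; rewrite -U'E in cntU'.
apply/validP => z; case: (eqVneq z y) => [->|zy].
  have [cy fy] := validP _ vD y.
  rewrite (below_eq U'z); last by rewrite neq_ltn ltnSn.
  split; first by rewrite U'E card_exchange.
  move=> a /bD'[[->]|ay].
    have := below_dom vD y (ltnW (ltn_ord x')); have := cntU' x'.+1.
    by rewrite ltnSn ltnS; have := cntS U x'; rewrite -/U; lia.
  by have := fy _ ay; have := cntU' a.+1; rewrite -/U; lia.
have [cz fz] := validP _ vD z.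
rewrite (U'z _ zy); case: (eqVneq (z : nat) y.+1) => [zS|zS]; last first.
  rewrite (below_eq U'z zS); split=> // a /bD'[[_ zE]|]; last exact: fz.
  by rewrite zE eqxx in zy.
have bz : below D z = U by rewrite (belowS D zS).
rewrite (belowS D' zS); rewrite bz in cz fz.
split=> [|a /bD'[[_ zE]|az]]; first by rewrite cz U'E card_exchange.
  by rewrite zE eqxx in zy.
set V := unmarked D z in cz fz *.
(* The moved box is topmost in its column, so the row above is empty at [x]. *)
have xz : (x, z) \notin boxes D.
  by apply/negP => xz; have := top z; rewrite xz zS ltnn.
have ax : a != x by apply: contraNneq xz => <-.
have {}ax : a != x :> nat by rewrite -val_eqE in ax.
have := fz _ az; have := cntU' a.
case: (leqP a x') => [ax'|x'a]; first by clear -ax'; lia.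
case: (ltnP x a) => [xa|xa]; first by clear -x'a xa; lia.
have {}xa : a < x by rewrite ltn_neqAle ax.
(* For [x' < a < x], all positions from [a] to [x] are unmarked in row [y], whereas the row above
   misses [x]. Dominance at [x.+1] therefore leaves one unit of slack at [a], which absorbs the
   arrival of [x']. *)
have runU : cnt U x.+1 = cnt U a + (x.+1 - a).
  apply: cnt_run => //; first exact/leqW/ltnW.
  move=> b /andP[ab]; rewrite ltnS leq_eqVlt => /orP[/eqP/val_inj -> //|bx].
  have bb : x' < b < x by rewrite bx (leq_trans x'a ab).
  by rewrite inE; have := btw b; have := btwm b; rewrite bb /= => -> ->.
have xV : x \notin V by rewrite inE (negbTE xz).
have := cntS V x; rewrite (negbTE xV) add0n.
have := cnt_slope V xa (ltnW (ltn_ord x)).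
have := below_dom vD z (ltn_ord x).
by rewrite bz -/U -/V; clear -xa runU; lia.
Qed.

Lemma valid_any_move D D' : valid D -> any_move D D' -> valid D'.
Proof.
move=> vD /orP[] /existsP[x /existsP[x' /existsP[y /and3P[mv /eqP bE /eqP mE]]]].
  have x'y : (x', y) \notin boxes D by case/and5P: mv => _ _ _ _ /and3P[].
  have x'm : (x', y) \notin marks D.
    by apply: contraNN x'y; apply/subsetP/(valP D).
  apply: (valid_step vD mv).
  - apply/setP => a; rewrite !inE bE mE !inE !xpair_eqE !eqxx !andbT.
    by case: (eqVneq a x') => [->|_] //=; rewrite andbA.
  - move=> z zy; apply/setP => a; rewrite !inE bE mE !inE !xpair_eqE.
    by rewrite (negbTE zy) !andbF.
  - by move=> b; rewrite bE !inE => /orP[/eqP|/andP[_]]; [left | right].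
have [x'x x'y] : x' < x /\ (x', y) \notin boxes D.
  by case/and5P: mv => _ _ _ -> /and3P[->].
have x'm : (x', y) \notin marks D.
  by apply: contraNN x'y; apply/subsetP/(valP D).
have xx' : x' != x by rewrite -val_eqE neq_ltn x'x.
apply: (valid_step vD mv).
- apply/setP => a; rewrite !inE bE mE !inE !xpair_eqE !eqxx !andbT.
  case: (eqVneq a x') => [->|_] /=; first by rewrite negb_or x'm xx'.
  by rewrite negb_or andbCA.
- move=> z zy; apply/setP => a; rewrite !inE bE mE !inE !xpair_eqE.
  by rewrite (negbTE zy) !andbF.
- by move=> b; rewrite bE !inE => /orP[/eqP|]; [left | right].
Qed.

(** * Reachability: undoing moves until the skyline is reached *)

Definition sky : diagram n m :=
  exist _ ([set b : box n m | b.1 \in f], set0) (sub0set _).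

Lemma unmarked_sky y : unmarked sky y = f.
Proof. by apply/setP => x; rewrite !inE andbT. Qed.

Lemma valid_sky : valid sky.
Proof.
apply/validP => y; have -> : below sky y = f.
  case: y => [[|y] ym]; first exact: below0.
  by rewrite (@belowS _ (Ordinal (ltnW ym))) // unmarked_sky.
by rewrite unmarked_sky; split=> // x; rewrite inE /= cntS => ->.
Qed.

(** Undoing a move shifts an unmarked box one column to the right, so this measure drops and the
    backward construction terminates. *)
Definition potential D : nat :=
  \sum_(b in boxes D :\: marks D) (n - b.1).

(** The undone move goes from column [t = x' + 1] to [x'] in row [y]. If [(t, y)] is occupied it
    carries a mark and a K-Kohnert move is undone; if it is empty, a Kohnert move is undone. *)
Lemma move_back_ex D x x' y : valid D ->
    x \in below D y -> x \notin unmarked D y -> x' \in unmarked D y -> x' < x ->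
    (forall z : 'I_n, x' < z < x -> z \notin unmarked D y) ->
    (forall z, cnt (unmarked D z) x.+1 = cnt f x.+1) ->
    cnt (below D y) x.+1 = cnt f x.+1 ->
  exists D0, [/\ valid D0, any_move D0 D & potential D0 < potential D].
Proof.
move=> vD xB xU x'U x'x gap cntx cntB.
have tn : x'.+1 < n by exact: leq_ltn_trans x'x (ltn_ord x).
pose t : 'I_n := Ordinal tn; set U := unmarked D y in xU x'U gap.
have gapU (z : 'I_n) : t <= z < x.+1 -> z \notin U.
  rewrite /= ltnS => /andP[x'z]; rewrite leq_eqVlt => /orP[/eqP/val_inj -> //|zx].
  by apply: gap; rewrite x'z.
have tU : t \notin U by apply: gapU; rewrite leqnn ltnS.
have cntUt : cnt U t = cnt f x.+1.
  by rewrite -(cntx y); apply/esym/cnt_gap => //; exact: ltnW.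
(* Position [x] of the row below lies at or to the right of [t], hence the strict inequality. It
   becomes the flag condition for the box restored at [t]. *)
have cntBt : cnt (below D y) t < cnt f x.+1.
  rewrite -cntB cntS xB; exact: cnt_mono.
(* Below [t], row [y] already has as many unmarked boxes as any row has up to [x]. A higher box in
   column [t] would need strictly more, so [(t, y)] is topmost before the move. *)
have topt z : y < z -> (t, z) \notin boxes D.
  move=> yz; apply/negP => tz; have [_ /(_ _ tz)] := validP _ vD z.
  rewrite ltnNge => /negP[]; apply: leq_trans (unmarked_dom vD yz (ltnW tn)).
  by rewrite -/U cntUt -(cntx z); apply: cnt_mono.
have x'y : (x', y) \in boxes D /\ (x', y) \notin marks D.
  by apply/andP; move: x'U; rewrite inE.
case: x'y => x'y x'm.
have tx' : t != x' by rewrite -val_eqE /= neq_ltn ltnSn orbT.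
(* These facts hold for both kinds of undone move, so validity and the drop of the potential are
   proved once. *)
suff [D0 [U0E U0z bD0 mv]] : exists D0, [/\ unmarked D0 y = t |: (U :\ x'),
    forall z, z != y -> unmarked D0 z = unmarked D z,
    forall b, b \in boxes D0 -> b = (t, y) \/ (b \in boxes D /\ b != (x', y)) &
    any_move D0 D].
  have cntU0 k := cnt_exchange k x'U tU; rewrite -U0E in cntU0.
  exists D0; split=> //.
    apply/validP => z; case: (eqVneq z y) => [->|zy].
      have [cy fy] := validP _ vD y.
      rewrite (below_eq U0z); last by rewrite neq_ltn ltnSn.
      split; first by rewrite U0E card_exchange.
      move=> a /bD0[[->]|[ay ax']].
        have c1 : cnt U t.+1 = cnt U t by rewrite cntS (negbTE tU).
        have c2 : x' < t.+1 by rewrite ltnS leqnSn.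
        have := cntU0 t.+1; rewrite c1 c2 ltnSn cntUt => /addIn ->.
        exact: cntBt.
      have {}ax' : a != x' :> nat.
        by apply: contraNneq ax' => /val_inj ->.
      by have := fy _ ay; have := cntU0 a.+1; rewrite -/U /=; clear -ax'; lia.
    have [cz fz] := validP _ vD z.
    rewrite (U0z _ zy); case: (eqVneq (z : nat) y.+1) => [zS|zS]; last first.
      rewrite (below_eq U0z zS); split=> // a /bD0[[_ zE]|[az _]]; last exact: fz.
      by rewrite zE eqxx in zy.
    rewrite (belowS D0 zS); rewrite (belowS D zS) in cz fz.
    split=> [|a /bD0[[_ zE]|[az _]]]; first by rewrite cz U0E card_exchange.
      by rewrite zE eqxx in zy.
    by have := fz _ az; have := cntU0 a; rewrite -/U /=; clear; lia.
  have BE : boxes D0 :\: marks D0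
      = (t, y) |: ((boxes D :\: marks D) :\ (x', y)).
    apply/setP => -[a z].
    have unmE (E : diagram n m) :
        ((a, z) \in boxes E :\: marks E) = (a \in unmarked E z).
      by rewrite !inE andbC.
    rewrite unmE in_setU1 in_setD1 unmE !xpair_eqE.
    case: (eqVneq z y) => [->|zy]; first by rewrite U0E !inE !andbT.
    by rewrite U0z // !andbF.
  have x'D : (x', y) \in boxes D :\: marks D by rewrite inE x'm.
  rewrite /potential BE big_setU1 /=; last first.
    rewrite !inE !negb_and; apply/orP; right.
    by move: tU; rewrite inE negb_and orbC.
  rewrite [ltnRHS](big_setD1 _ x'D) /= ltn_add2r.
  by have := ltn_ord x'; clear; lia.
have tm_notU : ((t, y) \in boxes D) = ((t, y) \in marks D).
  apply/idP/idP; last exact: (subsetP (valP D)).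
  by move: tU; rewrite inE negb_and negbK; case: (_ \in boxes D).
have mv D0 : (t, y) \in boxes D0 -> (t, y) \notin marks D0 ->
    (x', y) \notin boxes D0 ->
    (forall z, z != y -> (t, z) \in boxes D0 -> (t, z) \in boxes D) ->
    movable D0 t x' y.
  move=> ty tm x'y0 tz; apply/and5P; split=> //.
    apply/forallP => z; apply/implyP => tz0; rewrite leqNgt; apply/negP => yz.
    move: (topt _ yz); rewrite tz //; by rewrite -val_eqE neq_ltn yz orbT.
  rewrite x'y0 /=; apply/andP; split; apply/forallP => z /=;
    by apply/implyP => /andP[]; rewrite ltnS; case: ltngtP.
case: (boolP ((t, y) \in boxes D)) => ty.
  have sub : (marks D :\ (t, y)) \subset (boxes D :\ (x', y)).
    apply/subsetP => b; rewrite !inE => /andP[_ bm].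
    by rewrite (subsetP (valP D) _ bm) andbT; apply: contraNneq x'm => <-.
  exists (exist _ (boxes D :\ (x', y), marks D :\ (t, y)) sub); split.
  - apply/setP => a; rewrite !inE !xpair_eqE !eqxx !andbT.
    case: (eqVneq a t) => [->|_] /=; first by rewrite tx' ty.
    by rewrite andbA.
  - move=> z zy; apply/setP => a; rewrite !inE !xpair_eqE.
    by rewrite (negbTE zy) !andbF.
  - by move=> b; rewrite !inE => /andP[]; right.
  apply/orP; right; apply/existsP; exists t; apply/existsP; exists x'.
  apply/existsP; exists y; apply/and3P; split.
  - apply: mv; rewrite ?inE ?eqxx ?xpair_eqE ?negb_and ?tx' //=.
    by move=> z zy; rewrite !inE => /andP[].
  - by apply/eqP; rewrite /= setD1K.
  - by apply/eqP; rewrite /= setD1K // -tm_notU.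
have tm : (t, y) \notin marks D by rewrite -tm_notU.
have sub : marks D \subset (t, y) |: (boxes D :\ (x', y)).
  apply/subsetP => b bm; rewrite !inE (subsetP (valP D) _ bm) andbT.
  by apply/orP; right; apply: contraNneq x'm => <-.
exists (exist _ ((t, y) |: (boxes D :\ (x', y)), marks D) sub); split.
- apply/setP => a; rewrite !inE !xpair_eqE !eqxx !andbT.
  case: (eqVneq a t) => [->|_] //=.
  by rewrite andbA.
- move=> z zy; apply/setP => a; rewrite !inE !xpair_eqE.
  by rewrite (negbTE zy) !andbF.
- by move=> b; rewrite !inE => /orP[/eqP|/andP[]]; [left | right].
apply/orP; left; apply/existsP; exists t; apply/existsP; exists x'.
apply/existsP; exists y; apply/and3P; split=> //.
- apply: mv; rewrite ?inE ?eqxx //.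
  + by rewrite xpair_eqE eq_sym (negbTE tx').
  + by move=> z zy; rewrite !inE !xpair_eqE (negbTE zy) !andbF.
- apply/eqP; rewrite /= setU1K ?setD1K //.
  by rewrite in_setD1 (negbTE ty) andbF.
Qed.

Lemma move_back D : valid D -> D != sky ->
  exists D0, [/\ valid D0, any_move D0 D & potential D0 < potential D].
Proof.
move=> vD Dsky.
pose bad (b : box n m) := diag_row D b.2 b.1 != full_row f b.1.
have [b0 bad0] : exists b, bad b.
  apply/existsP; apply: contraNT Dsky; rewrite negb_exists => /forallP good.
  apply/eqP/val_inj; rewrite (surjective_pairing (val D)).
  have cE b := eqP (negbNE (good b)).
  congr (_, _); rewrite -?/(boxes D) -?/(marks D); apply/setP => -[x y];
    have := cE (x, y); rewrite !inE !ffunE /=.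
    by case: (_ \in boxes D); case: (_ \in f).
  case: (boolP ((x, y) \in marks D)) => // xm.
  by rewrite (subsetP (valP D) _ xm); case: ifP.
(* [x] is the rightmost column in which [D] differs from the skyline. *)
case: (arg_maxnP (fun b : box n m => b.1 : nat) bad0) => -[x y1] /= badx maxx.
have above z (k : 'I_n) : x < k -> (k \in unmarked D z) = (k \in f).
  move=> xk; have : ~~ bad (k, z).
    by apply/negP => /maxx /=; rewrite leqNgt xk.
  rewrite /bad negbK !ffunE inE /=.
  by case: (_ \in boxes D); case: (_ \in f) => //=; case: (_ \in marks D).
have cntx z : cnt (unmarked D z) x.+1 = cnt f x.+1.
  by apply: cnt_eq_above => [|k xk]; [apply: valid_card | apply: above].
(* Were [x] outside [f], a box in column [x] would need strictly more unmarked boxes up to [x] than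
   [f] has elements there, but the two numbers agree. *)
have xf : x \in f.
  apply: contraNT badx => xf; rewrite /bad !ffunE /= (negbTE xf).
  case: ifP => // xy1; have [_ /(_ _ xy1)] := validP _ vD y1.
  rewrite cntx cntS (negbTE xf) ltnNge => /negP[].
  exact/flag_dom/ltnW.
pose badr z := x \notin unmarked D z.
have bad1 : badr y1.
  rewrite /badr inE; move: badx; rewrite /bad !ffunE /= xf.
  by case: (_ \in boxes D) => //=; case: (_ \in marks D).
(* [y] is the lowest row without an unmarked box in column [x], so the row below it, or [f], does
   contain [x]. *)
case: (arg_minnP (fun z : 'I_m => z : nat) bad1) => y bady miny.
have cbelow : cnt (below D y) x.+1 = cnt f x.+1.
  case: (y) => [[|z] zm]; first by rewrite below0.
  by rewrite (@belowS _ (Ordinal (ltnW zm))).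
have xbelow : x \in below D y.
  case: y miny {bady cbelow} => [[|z] zm] miny; first by rewrite below0.
  rewrite (@belowS _ (Ordinal (ltnW zm))) //; apply: contraT => /miny.
  by rewrite ltnn.
(* Row [y] has as many unmarked boxes up to [x] as [f], yet misses [x]: one lies strictly to the
   left, and the nearest such is [x']. *)
have : 0 < cnt (unmarked D y) x.
  by have := cntx y; rewrite !cntS xf (negbTE bady) add0n => ->.
rewrite lt0n sum_nat_eq0 negb_forall => /existsP[x0].
rewrite negb_imply eqb0 negbK => /andP[x0u x0x].
pose P (k : 'I_n) := (k \in unmarked D y) && (k < x).
have P0 : P x0 by rewrite /P x0u.
case: (arg_maxnP (fun k : 'I_n => k : nat) P0) => x' /andP[x'u x'x] maxx'.
apply: (move_back_ex vD xbelow bady x'u x'x _ cntx cbelow).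
move=> z /andP[x'z zx]; apply/negP => zu.
by have := maxx' z; rewrite /P zu zx => /(_ isT) /(leq_trans x'z); rewrite ltnn.
Qed.

Lemma connect_sky D : connect (@any_move n m) sky D = valid D.
Proof.
apply/idP/idP => [/connectP[p pP ->]|].
  elim/last_ind: p pP => [|p E IH]; first by rewrite valid_sky.
  rewrite rcons_path last_rcons => /andP[/IH vE]; exact: valid_any_move.
have [k] := ubnP (potential D); elim: k D => // k IH D Dk vD.
have [->|Dsky] := eqVneq D sky; first exact: connect0.
have [D0 [vD0 mv D0D]] := move_back vD Dsky.
apply: connect_trans (connect1 mv); apply: IH => //.
exact: leq_trans D0D _.
Qed.

End Diagrams.

Local Open Scope ring_scope.

(** * Row weights and the row-by-row generating function *)

Definition cell_wt (n : nat) (s : option bool) (x : 'I_n) : betapoly n :=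
  match s with
  | None => 1
  | Some false => 'X_x
  | Some true => beta n * 'X_x
  end.

Definition row_wt (n : nat) (c : rowcfg n) : betapoly n :=
  \prod_x cell_wt (c x) x.

Fixpoint rows_gf (n s : nat) (f : {set 'I_n}) : betapoly n :=
  if s is s'.+1
  then \sum_(c : rowcfg n | flagged f c) row_wt c * rows_gf s' (unm c)
  else 1.

Lemma big_option_bool (V : nmodType) (F : option bool -> V) :
  \sum_p F p = F None + F (Some true) + F (Some false).
Proof.
rewrite (bigD1 None) // (bigD1 (Some true)) // (bigD1 (Some false)) //=.
by rewrite big1 ?addr0 ?addrA // => -[[]|].
Qed.

(* The part of the flag condition that concerns two adjacent columns l < h, with
   contents p and q: c and c' count the elements of the flag below l and h, d the
   unmarked boxes below l, and u the unmarked boxes of the pair. *)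
Definition pair_ok (c c' d u : nat) (p q : option bool) : bool :=
  [&& ((p == Some false) + (q == Some false) == u)%N,
      (p != None) ==> (c < d + (p == Some false))%N &
      (q != None) ==> (c' < d + ((p == Some false) + (q == Some false)))%N].

Ltac decide_leq :=
  repeat match goal with |- context [leq ?x ?y] =>
    (rewrite (_ : leq x y = true); last by lia)
    || (rewrite (_ : leq x y = false); last by lia) end;
  rewrite /=.

(** * The two-variable calculus of the operator, over an abstract domain with an involution *)

Section DemazureOperator.
Variables (R : idomainType) (sw vp : R -> R) (xl xh b : R).
Hypothesis swD : {morph sw : F G / F + G}.
Hypothesis swN : {morph sw : F / - F}.
Hypothesis swM : {morph sw : F G / F * G}.
Hypothesis sw1 : sw 1 = 1.
Hypothesis sw_lo : sw xl = xh.
Hypothesis sw_hi : sw xh = xl.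
Hypothesis sw_b : sw b = b.
Hypothesis swK : involutive sw.
Hypothesis subx_neq0 : xl - xh != 0.
Hypothesis vpE : forall F,
  (xl - xh) * vp F = xl * (1 + b * xh) * F - xh * (1 + b * xl) * sw F.

Let swE := (swD, swN, swM, sw1, sw_lo, sw_hi, sw_b, swK).

Lemma dem_eq F P :
  (xl - xh) * P = xl * (1 + b * xh) * F - xh * (1 + b * xl) * sw F -> vp F = P.
Proof. by rewrite -vpE => /(mulfI subx_neq0) ->. Qed.

Lemma demD : {morph vp : F G / F + G}.
Proof. by move=> F G; apply: dem_eq; rewrite mulrDr !vpE swD; ring. Qed.

Lemma dem0 : vp 0 = 0.
Proof. by apply: (addrI (vp 0)); rewrite -demD !addr0. Qed.

Lemma demMl S F : sw S = S -> vp (S * F) = S * vp F.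
Proof. by move=> sS; apply: dem_eq; rewrite mulrCA vpE swM sS; ring. Qed.

Lemma dem_id S : sw S = S -> vp S = S.
Proof. by move=> sS; apply: dem_eq; rewrite sS; ring. Qed.

(** The right-hand side of [vpE] is antisymmetric, and so is [xl - xh]. Hence the image of [vp] is
    symmetric, and [vp] is idempotent with the symmetric elements as its fixed points. *)
Lemma sw_dem F : sw (vp F) = vp F.
Proof.
apply: (mulfI subx_neq0).
have -> : (xl - xh) * sw (vp F) = - sw ((xl - xh) * vp F) by rewrite !swE; ring.
by rewrite vpE !swE; ring.
Qed.

Lemma demK F : vp (vp F) = vp F.
Proof. exact/dem_id/sw_dem. Qed.

Lemma sw_of_dem F : vp F = F -> sw F = F.
Proof. by move=> <-; exact: sw_dem. Qed.

Lemma dem_1lo S : vp S = S ->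
  vp ((1 + b * xl) * S) = (1 + b * xl) * (1 + b * xh) * S.
Proof. by move/sw_of_dem=> sS; apply: dem_eq; rewrite !swE sS; ring. Qed.

Lemma dem_lo F : vp (xl * F) = xl * (1 + b * xh) * F + xh * vp F.
Proof.
apply: dem_eq; rewrite mulrDr [_ * (xh * _)]mulrCA vpE !swE; ring.
Qed.

(** For [F = gl] the right-hand side is the one-box pair sum with all marks allowed, which thus lies
    in the image of [vp] and is fixed by it. *)
Lemma dem_lo1 F : vp (xl * (1 + b * xh) * F)
  = xl * (1 + b * xh) * F + xh * (1 + b * xl) * vp F.
Proof.
apply: dem_eq; rewrite mulrDr [_ * (xh * _ * _)]mulrCA vpE !swE; ring.
Qed.

Variables (g0 gl gh g2 : R).
Hypothesis vp_g0 : vp g0 = g0.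
Hypothesis vp_gl : vp gl = gh.
Hypothesis vp_g2 : vp g2 = g2.

Definition cell_mon (x : R) (p : option bool) : R :=
  match p with None => 1 | Some false => x | Some true => b * x end.

(** [g0], [gl], [gh], [g2] stand for the generating functions of the rows above, according to which
    columns of the pair hold unmarked boxes: none, left, right, both. *)
Definition pair_gf (p q : option bool) : R :=
  match p == Some false, q == Some false with
  | false, false => g0
  | true, false => gl
  | false, true => gh
  | true, true => g2
  end.

Definition pair_sum (c c' d u : nat) : R :=
  \sum_(p : option bool) \sum_(q : option bool)
    if pair_ok c c' d u p q
    then cell_mon xl p * cell_mon xh q * pair_gf p q else 0.

(** Equal bounds arise when the left column is outside the flag. *)
Lemma pair_sum_eq c d u : pair_sum c c d u =
  match u with
  | 0 => if (c < d)%N then (1 + b * xl) * (1 + b * xh) * g0 else g0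
  | 1 => if (c < d)%N then xl * (1 + b * xh) * gl + xh * (1 + b * xl) * gh
         else if c == d then xl * (1 + b * xh) * gl + xh * gh else 0
  | 2 => if (c <= d)%N then xl * xh * g2 else 0
  | _ => 0
  end.
Proof.
rewrite /pair_sum !big_option_bool /pair_ok /pair_gf /=.
case: u => [|[|[|u]]]; rewrite /= ?andbF ?andbT ?addr0 ?add0r //;
  case: (ltngtP c d) => cd; decide_leq; ring.
Qed.

(** Bounds differing by one arise when the left column belongs to the flag. *)
Lemma pair_sum_succ c d u : pair_sum c c.+1 d u =
  match u with
  | 0 => if (c.+1 < d)%N then (1 + b * xl) * (1 + b * xh) * g0
         else if c.+1 == d then (1 + b * xl) * g0 else g0
  | 1 => if (c < d)%N then xl * (1 + b * xh) * gl + xh * (1 + b * xl) * gh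
         else if c == d then xl * gl else 0
  | 2 => if (c <= d)%N then xl * xh * g2 else 0
  | _ => 0
  end.
Proof.
rewrite /pair_sum !big_option_bool /pair_ok /pair_gf /=.
case: u => [|[|[|u]]]; rewrite /= ?andbF ?andbT ?addr0 ?add0r //.
- by case: (ltngtP c.+1 d) => cd; decide_leq; ring.
- by case: (ltngtP c d) => cd; decide_leq; ring.
- by case: (ltngtP c d) => cd; decide_leq; ring.
Qed.

Lemma dem_full : vp ((1 + b * xl) * (1 + b * xh) * g0)
  = (1 + b * xl) * (1 + b * xh) * g0.
Proof. by apply: dem_id; rewrite !swE (sw_of_dem vp_g0); ring. Qed.

Lemma dem_both : vp (xl * xh * g2) = xl * xh * g2.
Proof. by apply: dem_id; rewrite !swE (sw_of_dem vp_g2); ring. Qed.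

Lemma dem_one : vp (xl * (1 + b * xh) * gl + xh * (1 + b * xl) * gh)
  = xl * (1 + b * xh) * gl + xh * (1 + b * xl) * gh.
Proof. by rewrite -vp_gl -dem_lo1 demK. Qed.

(** This is the case of a flag containing the left column only: exchanging it for the right one
    lowers the second bound from [c.+1] to [c]. *)
Lemma dem_pair_sum_up c d u :
  vp (pair_sum c c.+1 d u) = pair_sum c c d u.
Proof.
rewrite pair_sum_succ pair_sum_eq.
case: u => [|[|[|u]]]; rewrite ?dem0 //.
- case: (ltngtP c.+1 d) => cd; decide_leq; rewrite ?dem_full ?vp_g0 //.
  exact: dem_1lo.
- case: (ltngtP c d) => cd; rewrite ?dem_one ?dem0 //.
  by rewrite -vp_gl dem_lo.
- by case: ifP; rewrite ?dem_both ?dem0.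
Qed.

Lemma dem_pair_sum_eq c d u : vp (pair_sum c c d u) = pair_sum c c d u.
Proof.
rewrite pair_sum_eq; case: u => [|[|[|u]]]; rewrite ?dem0 //.
- by case: ifP; rewrite ?dem_full.
- case: ifP => _; first exact: dem_one.
  by case: ifP => _; rewrite ?dem0 // -vp_gl -dem_lo demK.
- by case: ifP; rewrite ?dem_both ?dem0.
Qed.

(* The hypothesis cannot be dropped: for u = 0 and d = c + 1 the sum is
   (1 + b * xl) * g0, which is not symmetric. *)
Lemma dem_pair_sum_both c d u : (c.+2 <= d + u)%N ->
  vp (pair_sum c c.+1 d u) = pair_sum c c.+1 d u.
Proof.
rewrite pair_sum_succ; case: u => [|[|[|u]]] cdu; rewrite ?dem0 //.
- by decide_leq; rewrite dem_full.
- by decide_leq; rewrite dem_one.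
- by case: ifP; rewrite ?dem_both ?dem0.
Qed.

End DemazureOperator.

(** * Instantiation with [varpi_op] and [swap_vars] on polynomials *)

Section Operators.
Variables (n : nat) (i : 'I_n.-1).
Implicit Types F S : betapoly n.
Local Notation xl := ('X_(lo i) : betapoly n).
Local Notation xh := ('X_(hi i) : betapoly n).
Local Notation b := (beta n).
Local Notation sw := (swap_vars i).
Local Notation vp := (varpi_op i).

Lemma lo_neq_hi : lo i != hi i.
Proof. by rewrite -val_eqE /= neq_ltn ltnSn. Qed.

Lemma swap_vars_beta : sw b = b.
Proof. by rewrite /swap_vars /beta /msym mmapC. Qed.

Lemma swap_varsX (x : 'I_n) : sw 'X_x = 'X_(simple_tr i x).
Proof. by rewrite /swap_vars /msym mmapX mmap1U. Qed.

Lemma simple_tr_lo : simple_tr i (lo i) = hi i.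
Proof. exact: tpermL. Qed.

Lemma simple_tr_hi : simple_tr i (hi i) = lo i.
Proof. exact: tpermR. Qed.

Lemma swap_varsK : involutive sw.
Proof. by move=> F; rewrite /swap_vars -msymMm tperm2 msym1m. Qed.

Lemma subX_neq0 : xl - xh != 0.
Proof.
rewrite subr_eq0; apply/negP => /eqP/(congr1 (mcoeff U_(lo i)%MM)).
rewrite !mcoeffXU eqxx eq_sym (negbTE lo_neq_hi) => /eqP.
by rewrite oner_eq0.
Qed.

Lemma swap_varsD F1 F2 : sw (F1 + F2) = sw F1 + sw F2.
Proof. exact: msymD. Qed.

Lemma swap_varsN F : sw (- F) = - sw F.
Proof. exact: msymN. Qed.

Lemma swap_varsM F1 F2 : sw (F1 * F2) = sw F1 * sw F2.
Proof. exact: msymM. Qed.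

Lemma swap_vars1 : sw 1 = 1.
Proof. exact: msym1. Qed.

Lemma swap_vars_lo : sw xl = xh.
Proof. by rewrite swap_varsX simple_tr_lo. Qed.

Lemma swap_vars_hi : sw xh = xl.
Proof. by rewrite swap_varsX simple_tr_hi. Qed.

Lemma varpi_opE F :
  (xl - xh) * vp F = xl * (1 + b * xh) * F - xh * (1 + b * xl) * sw F.
Proof.
rewrite /varpi_op /pi_op (eqP (xchooseP (pi_op_subproof i _))).
by rewrite swap_varsM swap_varsD swap_vars1 swap_varsM swap_vars_beta
  swap_vars_hi !mulrA.
Qed.

Lemma varpi_opD F1 F2 : vp (F1 + F2) = vp F1 + vp F2.
Proof. exact: (demD swap_varsD subX_neq0 varpi_opE). Qed.

Lemma varpi_op0 : vp 0 = 0.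
Proof. exact: (dem0 swap_varsD subX_neq0 varpi_opE). Qed.

Lemma varpi_op1 : vp 1 = 1.
Proof. exact: (dem_id subX_neq0 varpi_opE swap_vars1). Qed.

Lemma varpi_opMl S F : sw S = S -> vp (S * F) = S * vp F.
Proof. exact: (demMl swap_varsM subX_neq0 varpi_opE). Qed.

Lemma varpi_op_sum (I : finType) (P : pred I) (F : I -> betapoly n) :
  vp (\sum_(j | P j) F j) = \sum_(j | P j) vp (F j).
Proof. exact: (big_morph _ varpi_opD varpi_op0). Qed.

Section PairSum.
Variables (g0 gl gh g2 : betapoly n) (c d u : nat).
Hypotheses (vp_g0 : vp g0 = g0) (vp_gl : vp gl = gh) (vp_g2 : vp g2 = g2).
Local Notation psum := (pair_sum xl xh b g0 gl gh g2).

Lemma varpi_pair_sum_up : vp (psum c c.+1 d u) = psum c c d u.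
Proof.
exact: (dem_pair_sum_up swap_varsD swap_varsN swap_varsM swap_vars1
  swap_vars_lo swap_vars_hi swap_vars_beta swap_varsK subX_neq0 varpi_opE).
Qed.

Lemma varpi_pair_sum_eq : vp (psum c c d u) = psum c c d u.
Proof.
exact: (dem_pair_sum_eq swap_varsD swap_varsN swap_varsM swap_vars1
  swap_vars_lo swap_vars_hi swap_vars_beta swap_varsK subX_neq0 varpi_opE).
Qed.

Lemma varpi_pair_sum_both : (c.+2 <= d + u)%N ->
  vp (psum c c.+1 d u) = psum c c.+1 d u.
Proof.
exact: (dem_pair_sum_both swap_varsD swap_varsN swap_varsM swap_vars1
  swap_vars_lo swap_vars_hi swap_vars_beta swap_varsK subX_neq0 varpi_opE).
Qed.

End PairSum.

End Operators.

(** * Action of one operator on the generating function, by summing over two adjacent columns *)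

Section Filling.
Variables (n : nat) (i : 'I_n.-1).
Local Notation l := (lo i).
Local Notation h := (hi i).

Definition fill (c : rowcfg n) (p q : option bool) : rowcfg n :=
  [ffun x => if x == l then p else if x == h then q else c x].

Definition cleared (c : rowcfg n) : bool := (c l == None) && (c h == None).

(** The 0-Hecke action of the transposition on subsets: it exchanges upwards only, and is idempotent
    as [varpi_op i] is. *)
Definition raise (f : {set 'I_n}) : {set 'I_n} :=
  if (l \in f) && (h \notin f) then h |: (f :\ l) else f.

Lemma lo_hi_or (x : 'I_n) : x != l -> x != h -> (x < l)%N || (h < x)%N.
Proof. by rewrite -!val_eqE /=; lia. Qed.

Lemma fill_lo c p q : fill c p q l = p.
Proof. by rewrite ffunE eqxx. Qed.

Lemma fill_hi c p q : fill c p q h = q.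
Proof. by rewrite ffunE eq_sym (negbTE (lo_neq_hi i)) eqxx. Qed.

Lemma sum_fill (V : nmodType) (F : rowcfg n -> V) :
  \sum_c F c = \sum_(c | cleared c) \sum_p \sum_q F (fill c p q).
Proof.
rewrite (partition_big (fun c => fill c None None) cleared) /=; last first.
  by move=> c _; rewrite /cleared fill_lo fill_hi.
apply: eq_bigr => c /andP[/eqP cl /eqP ch]; rewrite pair_big /=.
rewrite (reindex_onto (fun pq => fill c pq.1 pq.2) (fun d => (d l, d h))) /=.
  apply: eq_bigl => -[p q]; rewrite fill_lo fill_hi eqxx andbT; apply/eqP.
  apply/ffunP => x; rewrite !ffunE; case: eqP => [->|_]; first by rewrite cl.
  by case: eqP => [->|_]; first by rewrite ch.
move=> d /eqP dE; apply/ffunP => x; rewrite -dE !ffunE.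
by case: eqP => [->|_] //; case: eqP => [->|_].
Qed.

Lemma unm_fill c p q : cleared c -> unm (fill c p q) =
  (if p == Some false then [set l] else set0) :|:
  (if q == Some false then [set h] else set0) :|: unm c.
Proof.
move=> /andP[/eqP cl /eqP ch]; apply/setP => x; rewrite !inE ffunE.
case: (eqVneq x l) => [->|xl].
  rewrite cl /= orbF; case: (p == _); rewrite !inE ?eqxx //.
  by case: (q == _); rewrite !inE // (negbTE (lo_neq_hi i)).
case: (eqVneq x h) => [->|xh].
  rewrite ch /= orbF; case: (q == _); rewrite !inE ?eqxx ?orbT // orbF.
  by case: (p == _); rewrite !inE // eq_sym (negbTE (lo_neq_hi i)).
by case: (p == _); case: (q == _); rewrite !inE ?(negbTE xl) ?(negbTE xh).
Qed.

Lemma cleared_unm c : cleared c -> (l \notin unm c) /\ (h \notin unm c).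
Proof. by case/andP => /eqP cl /eqP ch; rewrite !inE cl ch. Qed.

Lemma cnt_unm_fill c p q k : cleared c -> cnt (unm (fill c p q)) k =
  ((p == Some false) && (l < k) + ((q == Some false) && (h < k))
   + cnt (unm c) k)%N.
Proof.
move=> cc; have [lc hc] := cleared_unm cc; rewrite unm_fill //.
case: (p == _); case: (q == _); rewrite /= ?set0U ?setU0 -?setUA ?cntU1 ?addn0 ?addnA //.
by rewrite in_setU1 negb_or lo_neq_hi.
Qed.

Lemma cnt_unm_fill_rest c p q (x : 'I_n) : cleared c -> x != l -> x != h ->
  cnt (unm (fill c p q)) x.+1 = (cnt (unm c) x.+1
    + (if (h < x)%N then (p == Some false) + (q == Some false) else 0))%N.
Proof.
move=> cc xl xh; rewrite cnt_unm_fill // addnC !ltnS; congr (_ + _)%N.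
case/orP: (lo_hi_or xl xh) => [xi|hx].
  have xh' : (x < h)%N by exact: ltnW.
  by rewrite (leqNgt l) xi (leqNgt h) xh' (ltnNge h) (ltnW xh') !andbF.
by rewrite hx (ltnW hx) (leq_trans (leqnSn i) (ltnW hx)) !andbT.
Qed.

(** The flag condition away from the pair. Cardinality forces the pair to hold [#|f| - #|unm c|]
    unmarked boxes, and columns to its right see only this number. *)
Definition rest_ok (f : {set 'I_n}) (c : rowcfg n) : bool :=
  (#|unm c| <= #|f|)%N &&
  [forall x : 'I_n, (c x != None) ==>
    (cnt f x < cnt (unm c) x.+1 + (if (h < x)%N then #|f| - #|unm c| else 0))%N].

Lemma flagged_fill f c p q : cleared c ->
  flagged f (fill c p q) = rest_ok f c
    && pair_ok (cnt f l) (cnt f h) (cnt (unm c) l) (#|f| - #|unm c|) p q.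
Proof.
move=> cc; have [lc hc] := cleared_unm cc.
have [cl ch] : c l = None /\ c h = None by case/andP: cc => /eqP -> /eqP ->.
have cntl : cnt (unm c) l.+1 = cnt (unm c) l by rewrite cntS (negbTE lc).
have cnth : cnt (unm c) h.+1 = cnt (unm c) l.
  by rewrite cntS (negbTE hc) add0n -cntl.
have card_fill := cnt_unm_fill p q n cc.
move: card_fill; rewrite !cnt_all !ltn_ord !andbT => card_fill.
rewrite /flagged card_fill /rest_ok /pair_ok.
set u := ((_ == _) + (_ == _))%N in card_fill *.
(* The bound on [#|unm c|] is split off because the subtraction is truncated. *)
have -> : (u + #|unm c| == #|f|)%N
    = (#|unm c| <= #|f|)%N && (u == #|f| - #|unm c|)%N by lia.
rewrite -!andbA; case: (leqP #|unm c| #|f|) => // cf; rewrite !andTb.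
case: eqP => [uE|_]; last by rewrite andbF.
rewrite -uE; apply/forallP/andP => [fP|[/forallP rP okP] x].
  split.
    apply/forallP => x; apply/implyP => cx.
    have xl : x != l by apply: contraNneq cx => ->; rewrite cl.
    have xh : x != h by apply: contraNneq cx => ->; rewrite ch.
    have := fP x; rewrite ffunE (negbTE xl) (negbTE xh) cx /=.
    by rewrite cnt_unm_fill_rest.
  have := fP l; have := fP h; rewrite fill_lo fill_hi.
  rewrite !cnt_unm_fill // cntl cnth /=.
  rewrite (_ : i < i.+2)%N // ltnSn (_ : (i.+1 < i.+1)%N = false) ?ltnn //.
  rewrite !andbT andbF addn0 => qP pP.
  apply/andP; split; apply/implyP => pqN; [move: pP | move: qP];
    by rewrite pqN /=; lia.
apply/implyP; rewrite ffunE.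
case: (eqVneq x l) => [->|xl].
  move=> pN; move: okP; rewrite pN /= => /andP[+ _].
  by rewrite cnt_unm_fill // cntl /=; lia.
case: (eqVneq x h) => [->|xh].
  move=> qN; move: okP; rewrite qN /= => /andP[_].
  by rewrite cnt_unm_fill // cnth /= /u; lia.
by move=> cx; have := rP x; rewrite cx /= cnt_unm_fill_rest.
Qed.

Lemma row_wt_fill c p q : cleared c -> row_wt (fill c p q) =
  row_wt c * (cell_mon (beta n) 'X_l p * cell_mon (beta n) 'X_h q).
Proof.
case/andP => /eqP cl /eqP ch; have hl : h != l by rewrite eq_sym lo_neq_hi.
rewrite /row_wt (bigD1 l) // (bigD1 h) //= fill_lo fill_hi.
rewrite [in RHS](bigD1 l) // [in RHS](bigD1 h) //= cl ch !mul1r.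
rewrite [LHS]mulrA [LHS]mulrC; congr (_ * _).
by apply: eq_bigr => x /andP[/negbTE xl /negbTE xh]; rewrite ffunE xl xh.
Qed.

Lemma swap_row_wt c : cleared c -> swap_vars i (row_wt c) = row_wt c.
Proof.
case/andP => /eqP cl /eqP ch.
rewrite /row_wt (big_morph _ (@swap_varsM n i) (@swap_vars1 n i)).
apply: eq_bigr => x _; case: (eqVneq x l) => [->|xl].
  by rewrite cl swap_vars1.
case: (eqVneq x h) => [->|xh]; first by rewrite ch swap_vars1.
have trx : simple_tr i x = x by rewrite /simple_tr tpermD // eq_sym.
case: (c x) => [[]|] /=; rewrite ?swap_vars1 ?swap_varsM ?swap_vars_beta //;
  by rewrite swap_varsX trx.
Qed.

Definition rest_pair_sum s (f : {set 'I_n}) c : betapoly n :=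
  pair_sum 'X_l 'X_h (beta n)
    (rows_gf s (unm c)) (rows_gf s (l |: unm c)) (rows_gf s (h |: unm c))
    (rows_gf s (l |: (h |: unm c)))
    (cnt f l) (cnt f h) (cnt (unm c) l) (#|f| - #|unm c|).

Lemma rows_gf_cleared s f : rows_gf s.+1 f =
  \sum_(c | cleared c && rest_ok f c) row_wt c * rest_pair_sum s f c.
Proof.
rewrite /= big_mkcond sum_fill [RHS]big_mkcondr /=; apply: eq_bigr => c cc.
rewrite /rest_pair_sum /pair_sum; case: (boolP (rest_ok f c)) => okc; last first.
  by rewrite big1 // => p _; rewrite big1 // => q _; rewrite flagged_fill // (negbTE okc).
rewrite mulr_sumr; apply: eq_bigr => p _; rewrite mulr_sumr.
apply: eq_bigr => q _; rewrite flagged_fill // okc /=.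
case: ifP => _; last by rewrite mulr0.
rewrite row_wt_fill // -!mulrA; do 3!congr (_ * _).
rewrite unm_fill // /pair_gf.
by case: (p == _); case: (q == _); rewrite ?set0U ?setU0 -?setUA.
Qed.

Lemma raise_lo (f : {set _}) : l \in f -> h \notin f -> raise f = h |: (f :\ l).
Proof. by rewrite /raise => -> ->. Qed.

Lemma card_raise (f : {set _}) : #|raise f| = #|f|.
Proof.
rewrite /raise; case: ifP => // /andP[lf hf].
by rewrite cardsU1 (cardsD1 l f) lf !inE negb_and hf orbT.
Qed.

Lemma cnt_raise (f : {set _}) k : l \in f -> h \notin f ->
  (cnt (raise f) k + (l < k) = cnt f k + (h < k))%N.
Proof.
move=> lf hf; have E := cntD1 k lf; rewrite raise_lo // cntU1.
  by rewrite E addnC addnA addnAC.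
by rewrite !inE negb_and hf orbT.
Qed.

(** Only a count that stops between the two columns, that is at [h], can detect the exchange. *)
Lemma cnt_raise_neq (f : {set _}) k :
  k != h :> nat -> cnt (raise f) k = cnt f k.
Proof.
move=> kh; rewrite /raise; case: ifP => // /andP[lf hf].
have lhk : (l < k)%N = (h < k)%N by move: kh => /=; lia.
by have := cnt_raise k lf hf; rewrite raise_lo // lhk => /addIn.
Qed.

Lemma rest_ok_raise f c : cleared c -> rest_ok (raise f) c = rest_ok f c.
Proof.
case/andP => cl ch; rewrite /rest_ok card_raise; congr (_ && _).
apply: eq_forallb => x; case: (eqVneq x h) => [->|xh]; first by rewrite (eqP ch).
by rewrite cnt_raise_neq.
Qed.

(** This is [cnt_dom] beyond the pair, with [u] the number of unmarked boxes missing from [c]. It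
    supplies the inequality required by [varpi_pair_sum_both]. *)
Lemma cnt_rest_ok f c : cleared c -> rest_ok f c ->
  (cnt f h.+1 <= cnt (unm c) l + (#|f| - #|unm c|))%N.
Proof.
move=> cc /andP[cf /forallP fP]; have [lc hc] := cleared_unm cc.
have -> : cnt (unm c) l = cnt (unm c) h.+1.
  rewrite cntS (negbTE hc) add0n.
  have -> : cnt (unm c) h = cnt (unm c) l.+1 by [].
  by rewrite cntS (negbTE lc).
apply: cnt_dom => [||x xc hx]; [by rewrite subnKC | exact: ltn_ord |].
by have := fP x; rewrite hx; move: xc; rewrite inE => /eqP ->.
Qed.

(** Induction on the number of rows. The weight outside the pair is symmetric in the two variables
    and [rest_ok] is unchanged by [raise], so the operator acts on each pair sum alone; the
    induction hypothesis gives its effect on the rows above. *)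
Lemma varpi_rows_gf s f : varpi_op i (rows_gf s f) = rows_gf s (raise f).
Proof.
elim: s f => [|s IH] f.
  exact: varpi_op1.
rewrite !rows_gf_cleared varpi_op_sum.
rewrite [RHS](eq_bigl (fun c => cleared c && rest_ok f c)); last first.
  by move=> c; case: (boolP (cleared c)) => //= cc; rewrite rest_ok_raise.
apply: eq_bigr => c /andP[cc okc].
rewrite varpi_opMl ?swap_row_wt //; congr (_ * _).
have [lc hc] := cleared_unm cc.
have g0 : varpi_op i (rows_gf s (unm c)) = rows_gf s (unm c).
  by rewrite IH /raise (negbTE lc).
have g2 : varpi_op i (rows_gf s (l |: (h |: unm c)))
    = rows_gf s (l |: (h |: unm c)).
  by rewrite IH /raise !in_setU1 !eqxx orbT andbF.
have gl : varpi_op i (rows_gf s (l |: unm c)) = rows_gf s (h |: unm c).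
  rewrite IH raise_lo ?setU1K ?setU11 //.
  by rewrite in_setU1 negb_or hc eq_sym lo_neq_hi.
rewrite /rest_pair_sum card_raise (@cnt_raise_neq f l); last first.
  by rewrite /= neq_ltn ltnSn.
have cntl : cnt f h = ((l \in f) + cnt f l)%N by rewrite -cntS.
case: (boolP (l \in f)) cntl => lf cntl; rewrite cntl ?add1n ?add0n; last first.
  rewrite /raise (negbTE lf) /= cntl.
  exact: varpi_pair_sum_eq.
case: (boolP (h \in f)) => hf.
  rewrite /raise lf hf /= cntl add1n.
  apply: varpi_pair_sum_both => //.
  by have := cnt_rest_ok cc okc; rewrite cntS hf cntl.
have -> : cnt (raise f) h = cnt f l.
  by have := cnt_raise h lf hf; rewrite cntl /= ltnSn ltnn; lia.
exact: varpi_pair_sum_up.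
Qed.

End Filling.

(** * Diagrams as tuples of rows, and their weighted sum *)

Lemma wt_beta_rows (n m : nat) (D : diagram n m) :
  wt_beta D = \prod_(y < m) row_wt (diag_row D y).
Proof.
rewrite /row_wt exchange_big pair_big /=.
transitivity (\prod_(b : box n m) ((if b \in marks D then beta n else 1)
    * (if b \in boxes D then 'X_b.1 else 1))); last first.
  apply: eq_bigr => -[x y] _ /=; rewrite ffunE.
  case: (boolP ((x, y) \in marks D)) => [xm|_].
    by rewrite (subsetP (valP D) _ xm).
  by case: ifP => _; rewrite mul1r.
rewrite big_split /= -!big_mkcond /= prodr_const; congr (_ * _).
rewrite [RHS](partition_big (fun b : box n m => b.1) xpredT) //=.
apply: eq_bigr => x _; rewrite /col_count -prodr_const.
rewrite [LHS](eq_bigl (fun b : box n m => (b \in boxes D) && (b.1 == x))); last first.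
  by move=> b; rewrite inE.
by apply: eq_bigr => b /andP[_ /eqP ->].
Qed.

Lemma sum_tuple_cons (T : finType) (V : nmodType) (k : nat)
    (F : k.+1.-tuple T -> V) :
  \sum_t F t = \sum_c \sum_(t : k.-tuple T) F [tuple of c :: t].
Proof.
rewrite pair_big /=.
rewrite (reindex (fun ct : T * k.-tuple T => [tuple of ct.1 :: ct.2])) //=.
exists (fun t : k.+1.-tuple T => (thead t, [tuple of behead t])).
  by move=> [c t] _; congr (_, _); apply: val_inj.
by move=> t _; rewrite [RHS]tuple_eta.
Qed.

(** Splitting off the first row of a [flag_rel] path reproduces the recursion of [rows_gf]. *)
Lemma rows_gf_path (n m : nat) (c : rowcfg n) :
  \sum_(t : m.-tuple (rowcfg n) | path (@flag_rel n) c t)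
    \prod_(y < m) row_wt (tnth t y) = rows_gf m (unm c).
Proof.
elim: m c => [|m IH] c.
  rewrite (big_pred1 [tuple]) ?big_ord0 // => t.
  by rewrite tuple0 /= eqxx.
rewrite big_mkcond sum_tuple_cons /= [RHS]big_mkcond; apply: eq_bigr => d _.
rewrite {1}/flag_rel; case: ifP => cd; last by rewrite big1.
rewrite -IH mulr_sumr [RHS]big_mkcond; apply: eq_bigr => t _ /=.
case: ifP => // _; rewrite big_ord_recl; congr (_ * _).
by apply: eq_bigr => y _; rewrite tnthS.
Qed.

Definition rows_diag (n m : nat) (t : m.-tuple (rowcfg n)) : diagram n m.
Proof.
exists ([set b | tnth t b.2 b.1 != None], [set b | tnth t b.2 b.1 == Some true]).
by apply/subsetP => b; rewrite !inE => /eqP ->.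
Defined.

Lemma rowsK (n m : nat) : cancel (@rows n m) (@rows_diag n m).
Proof.
move=> D; apply/val_inj; rewrite [RHS]surjective_pairing /=.
congr (_, _); apply/setP => -[x y]; rewrite inE tnth_mktuple ffunE /=.
  by rewrite -/(boxes D); case: ifP.
rewrite -/(marks D); case: (boolP ((x, y) \in marks D)) => xm.
  by rewrite (subsetP (valP D) _ xm).
by case: ifP.
Qed.

Lemma rows_diagK (n m : nat) : cancel (@rows_diag n m) (@rows n m).
Proof.
move=> t; apply: eq_from_tnth => y; rewrite tnth_mktuple.
apply/ffunP => x; rewrite ffunE !inE /=.
by case: (tnth t y x) => [[]|].
Qed.

Lemma diagram_gf (n m : nat) (f : {set 'I_n}) :
  \sum_(D : diagram n m | connect (@any_move n m) (sky m f) D) wt_beta D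
    = rows_gf m f.
Proof.
rewrite -[in RHS](unm_full_row f) -rows_gf_path.
rewrite (reindex (@rows n m)); last first.
  by exists (@rows_diag n m) => [D _|t _]; [apply: rowsK | apply: rows_diagK].
apply: eq_big => [D|D _]; first by rewrite connect_sky.
by rewrite wt_beta_rows; apply: eq_bigr => y _; rewrite tnth_mktuple.
Qed.

(** * Words in simple transpositions acting on subsets, measured by the sum of the elements *)

Definition energy (n : nat) (f : {set 'I_n}) : nat := (\sum_(x in f) x)%N.

Section Words.
Variable n : nat.
Implicit Types (i : 'I_n.-1) (f : {set 'I_n}) (u : seq 'I_n.-1) (w : 'S_n).

Lemma simple_trK i : involutive (simple_tr i).
Proof. by move=> x; rewrite -permM tperm2 perm1. Qed.

Lemma simple_tr_raise i f : lo i \in f -> hi i \notin f ->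
  simple_tr i @: f = raise i f.
Proof.
move=> lf hf; rewrite raise_lo //; apply/setP => x.
rewrite -[x in LHS](simple_trK i) mem_imset; last exact: perm_inj.
rewrite !inE /simple_tr; case: tpermP => [->|->|/eqP xl /eqP xh].
- by rewrite (negbTE hf) (negbTE (lo_neq_hi i)) eqxx.
- by rewrite lf eqxx.
- by rewrite (negbTE xl) (negbTE xh).
Qed.

Lemma simple_tr_stable i f : (lo i \in f) = (hi i \in f) ->
  simple_tr i @: f = f.
Proof.
move=> lh; apply/setP => x.
rewrite -[x in LHS](simple_trK i) mem_imset; last exact: perm_inj.
by rewrite /simple_tr; case: tpermP => [->|->|].
Qed.

Lemma simple_tr_inv i f : simple_tr i @: (simple_tr i @: f) = f.
Proof.
rewrite -imset_comp -[RHS]imset_id; apply: eq_imset => x /=.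
exact: simple_trK.
Qed.

Lemma energy_raise i f : lo i \in f -> hi i \notin f ->
  energy (raise i f) = (energy f).+1.
Proof.
move=> lf hf; rewrite raise_lo // /energy big_setU1 /=.
  by rewrite [in RHS](big_setD1 _ lf).
by rewrite !inE negb_and hf orbT.
Qed.

Lemma simple_tr_cases i f :
  [\/ lo i \in f /\ hi i \notin f,
      simple_tr i @: f = f |
      lo i \in simple_tr i @: f /\ hi i \notin simple_tr i @: f].
Proof.
have mem x : (x \in simple_tr i @: f) = (simple_tr i x \in f).
  by rewrite -[x in LHS](simple_trK i) mem_imset //; apply: perm_inj.
rewrite !mem simple_tr_lo simple_tr_hi.
case lf: (lo i \in f); case hf: (hi i \in f).
- by constructor 2; apply: simple_tr_stable; rewrite lf hf.
- by constructor 1.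
- by constructor 3.
- by constructor 2; apply: simple_tr_stable; rewrite lf hf.
Qed.

Lemma word_imset_cons i u f :
  word_perm (i :: u) @: f = simple_tr i @: (word_perm u @: f).
Proof.
by rewrite -imset_comp; apply: eq_imset => x /=; rewrite permM.
Qed.

Lemma energy_simple_tr i f : (energy (simple_tr i @: f) <= (energy f).+1)%N.
Proof.
case: (simple_tr_cases i f) => [[lf hf]|->|[lf hf]]; rewrite ?leqnSn //.
  by rewrite simple_tr_raise ?energy_raise.
have := energy_raise lf hf; rewrite -simple_tr_raise // simple_tr_inv => ->.
by rewrite leqW.
Qed.

(** Each letter raises the energy by at most one, so the energy gain bounds the length of a word
    from below. *)
Lemma energy_word u f : (energy (word_perm u @: f) <= energy f + size u)%N.
Proof.
elim: u => [|i u IH].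
  by rewrite /= addn0 (eq_imset (g := id)) ?imset_id // => x; rewrite perm1.
rewrite word_imset_cons /= addnS.
exact: leq_trans (energy_simple_tr _ _) _.
Qed.

(** Equality in [energy_word] forces every letter to gain exactly one, so at each letter [raise]
    coincides with the transposition. *)
Lemma varpi_word_rows_gf s u f :
  energy (word_perm u @: f) = (energy f + size u)%N ->
  varpi_word u (rows_gf s f) = rows_gf s (word_perm u @: f).
Proof.
elim: u => [_|i u IH].
  by rewrite /= (eq_imset (g := id)) ?imset_id // => x; rewrite perm1.
rewrite word_imset_cons /= addnS; set g := word_perm u @: f => gE.
have gu : energy g = (energy f + size u)%N.
  have := energy_simple_tr i g; have := energy_word u f; rewrite -/g gE; lia.
rewrite /varpi_word /= -/(varpi_word u _) IH // varpi_rows_gf.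
case: (simple_tr_cases i g) => [[lg hg]|sg|[lg hg]].
- by rewrite simple_tr_raise.
- by move: gE; rewrite sg gu; lia.
- have := energy_raise lg hg; rewrite -simple_tr_raise // simple_tr_inv gE gu.
  by lia.
Qed.

Definition down_closed f : Prop :=
  forall x y : 'I_n, (x < y)%N -> y \in f -> x \in f.

Lemma down_closed_eq f g :
  down_closed f -> down_closed g -> #|f| = #|g| -> f = g.
Proof.
move=> df dg fg; apply/eqP; rewrite eqEcard fg leqnn andbT.
apply: contraT => /subsetPn[x xf xg]; suff: g \proper f.
  by move/proper_card; rewrite fg ltnn.
apply/properP; split; last by exists x.
apply/subsetP => y yg; case: (ltngtP x y) => [xy|yx|/val_inj <- //].
  by rewrite (dg _ _ xy yg) in xg.
exact: df _ _ yx xf.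
Qed.

(** Induction on the energy: a gap immediately followed by an element can be undone at a gain of one
    letter. Without such a place the set is an initial segment, and its cardinality makes it
    [f0]. *)
Lemma word_exists f0 f : down_closed f0 -> #|f| = #|f0| ->
  exists u, word_perm u @: f0 = f /\ energy f = (energy f0 + size u)%N.
Proof.
move=> d0; have [k] := ubnP (energy f); elim: k f => // k IH f fk ff0.
case: (pickP (fun i => (lo i \notin f) && (hi i \in f))) => [i /andP[lf hf]|none].
  pose g := simple_tr i @: f.
  have gf : simple_tr i @: g = f by apply: simple_tr_inv.
  have mem x : (x \in g) = (simple_tr i x \in f).
    by rewrite -[x in LHS](simple_trK i) mem_imset //; apply: perm_inj.
  have lg : lo i \in g by rewrite mem simple_tr_lo.
  have hg : hi i \notin g by rewrite mem simple_tr_hi.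
  have fE : energy f = (energy g).+1.
    by rewrite -(energy_raise lg hg) -simple_tr_raise // gf.
  have [|u [uE Eu]] := IH g _ (etrans (card_imset _ (@perm_inj _ _)) ff0).
    by rewrite fE in fk.
  by exists (i :: u); rewrite word_imset_cons uE gf fE Eu addnS.
exists [::]; rewrite /= addn0 (eq_imset (g := id)) ?imset_id; last first.
  by move=> x; rewrite perm1.
suff -> : f = f0 by [].
apply: down_closed_eq => // x y.
move dE : (y - x)%N => d; elim: d x dE => [|d IHd] x dE xy yf; first by lia.
have xn : (x.+1 < n)%N by apply: leq_ltn_trans xy (ltn_ord y).
have xn' : (x < n.-1)%N by lia.
pose i : 'I_n.-1 := Ordinal xn'.
have xE : lo i = x by apply: val_inj.
have hf : hi i \in f.
  have [yx|yx] := eqVneq (y : nat) x.+1.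
    by rewrite (_ : hi i = y) //; apply: val_inj.
  by apply: IHd => //=; lia.
by have := none i; rewrite hf andbT xE => /negbFE.
Qed.

Lemma perm_len_le u w : word_perm u = w -> (perm_len w <= size u)%N.
Proof.
move=> uw; rewrite /perm_len; case: ex_minnP => k _; apply.
by apply/existsP; exists (in_tuple u); apply/eqP.
Qed.

Lemma reduced_wordP w :
  word_perm (reduced_word w) = w /\ size (reduced_word w) = perm_len w.
Proof.
by have /andP[/eqP ? /eqP ?] := xchooseP (reduced_word_subproof w).
Qed.

End Words.

(** * Initial segments as flags: a single diagram and the leading monomial *)

Lemma flagged_full_row (n : nat) (f : {set 'I_n}) : flagged f (full_row f).
Proof.
rewrite /flagged unm_full_row eqxx; apply/forallP => x; apply/implyP.
by rewrite ffunE; case: ifP => // xf _; rewrite cntS xf.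
Qed.

(** A box outside the segment would have all of [f] to its left, which the strict bound excludes.
    The unmarked boxes then fill [f] by cardinality, leaving no place for marks. *)
Lemma flagged_down_closed (n : nat) (f : {set 'I_n}) (c : rowcfg n) :
  down_closed f -> flagged f c = (c == full_row f).
Proof.
move=> df; apply/idP/eqP => [/andP[/eqP cf /forallP fc]|->]; last first.
  exact: flagged_full_row.
have occ x : c x != None -> x \in f.
  move=> cx; apply: contraTT (implyP (fc x) cx) => xf.
  rewrite -leqNgt; apply: (@leq_trans #|unm c|).
    by rewrite -cnt_all cnt_mono.
  rewrite cf -[leqRHS]addn0 -(subnn x) -cnt_all (@cnt_gap _ f x n) //.
  - by rewrite subnn addn0.
  - exact: ltnW.
  - move=> y /andP[xy _]; apply: contraNN xf => yf.
    by move: xy; rewrite leq_eqVlt => /orP[/eqP/val_inj -> //|/df]; apply.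
have uf : unm c = f.
  apply/eqP; rewrite eqEcard cf leqnn andbT; apply/subsetP => x.
  by rewrite inE => /eqP cx; apply: occ; rewrite cx.
apply/ffunP => x; rewrite ffunE; case: ifP => [|xf].
  by rewrite -[in X in X -> _]uf inE => /eqP.
by apply/eqP; apply: contraFT xf; apply: occ.
Qed.

Lemma rows_gf_down_closed (n s : nat) (f : {set 'I_n}) : down_closed f ->
  rows_gf s f = \prod_(x < n) 'X_x ^+ (if x \in f then s else 0%N).
Proof.
move=> df; elim: s => [|s IH].
  by rewrite big1 // => x _; case: ifP.
rewrite /= (big_pred1 (full_row f)); last first.
  by move=> c; apply: flagged_down_closed.
rewrite unm_full_row IH -big_split; apply: eq_bigr => x _ /=.
by rewrite ffunE; case: ifP; rewrite ?mulr1 // exprS.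
Qed.

(** * Rectangular compositions, determined by their support, and the conclusion *)

Definition supp (n : nat) (a : n.-tuple nat) : {set 'I_n} :=
  [set x | tnth a x != 0%N].

Lemma supp_perm_act (n : nat) (w : 'S_n) (a : n.-tuple nat) :
  supp (perm_act w a) = w @: supp a.
Proof.
apply/setP => x; rewrite -[x](permKV w) mem_imset; last exact: perm_inj.
by rewrite !inE tnth_mktuple permK.
Qed.

Lemma tuple_supp_eq (n s : nat) (a b : n.-tuple nat) :
  (forall x, x \in supp a -> tnth a x = s) ->
  (forall x, x \in supp b -> tnth b x = s) -> supp a = supp b -> a = b.
Proof.
move=> aP bP ab; apply: eq_from_tnth => x.
have [xa|xa] := boolP (x \in supp a); first by rewrite aP // bP // -ab.
by move: xa (xa); rewrite {2}ab !inE !negbK => /eqP -> /eqP ->.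
Qed.

Section Rectangle.
Variables (n : nat) (a : n.-tuple nat).
Hypothesis ha : forall i j : 'I_n,
  tnth a i != 0%N -> tnth a j != 0%N -> tnth a i = tnth a j.

Lemma tnth_supp x : x \in supp a -> tnth a x = height a.
Proof.
rewrite inE => ax; apply/eqP; rewrite eqn_leq leq_bigmax /=.
apply/bigmax_leqP => y _; have [->|ay] := eqVneq (tnth a y) 0%N; first by [].
by rewrite (ha ax ay).
Qed.

Lemma tnth_sorted_supp x :
  x \in supp (sorted_part a) -> tnth (sorted_part a) x = height a.
Proof.
rewrite inE => ax; have : tnth (sorted_part a) x \in a.
  by rewrite -(mem_sort geq) mem_tnth.
move/tnthP => [y yE]; rewrite yE in ax *.
by apply: tnth_supp; rewrite inE.
Qed.

Lemma supp_sorted_down_closed : down_closed (supp (sorted_part a)).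
Proof.
move=> x y xy; rewrite !inE -!lt0n => /leq_trans; apply.
rewrite !(tnth_nth 0%N).
apply: (sorted_ltn_nth (leT := geq)) => //; rewrite ?inE ?size_tuple //.
  by move=> p q r /= qp rp; apply: leq_trans rp qp.
by apply: sort_sorted => p q; apply: leq_total.
Qed.

Lemma skyline_sky : skyline a = sky (height a) (supp a).
Proof.
apply: val_inj; congr (_, _); apply/setP => -[x y]; rewrite !inE /=.
have [->|ax] := eqVneq (tnth a x) 0%N; first by rewrite ltn0.
by rewrite tnth_supp ?ltn_ord // inE.
Qed.

Lemma lascoux_rows_gf : lascoux a = rows_gf (height a) (supp a).
Proof.
rewrite /lascoux /varpi_perm /min_coset_rep; set mu := sorted_part a.
have -> : \prod_(i < n) 'X_i ^+ tnth mu i = rows_gf (height a) (supp mu).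
  rewrite (rows_gf_down_closed _ supp_sorted_down_closed).
  apply: eq_bigr => x _; congr (_ ^+ _); case: ifP => xm.
    exact: tnth_sorted_supp.
  by move: xm; rewrite inE => /negbFE/eqP.
case: arg_minnP => [|w /eqP wa wmin]; first exact: (xchooseP (sorting_perm_subproof a)).
have [uw us] := reduced_wordP w.
have supp_a : supp a = w @: supp mu by rewrite -supp_perm_act wa.
have card_a : #|supp a| = #|supp mu| by rewrite supp_a card_imset //; apply: perm_inj.
have [v [vE Ev]] := word_exists supp_sorted_down_closed card_a.
(* The permutation of [v] also takes [mu] to [a], as both have the same constant on their supports;
   minimality of [w] bounds its length by [size v], the energy gain. With [energy_word] as the
   reverse bound, the reduced word of [w] gains exactly its length. *)
have wv : (perm_len w <= size v)%N.
  apply: leq_trans (perm_len_le (erefl (word_perm v))); apply: wmin.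
  apply/eqP; apply: (@tuple_supp_eq _ (height a)).
  - move=> x; rewrite inE tnth_mktuple => xm; apply: tnth_sorted_supp.
    by rewrite inE.
  - exact: tnth_supp.
  - by rewrite supp_perm_act.
rewrite varpi_word_rows_gf uw -supp_a //.
have := energy_word (reduced_word w) (supp mu).
by rewrite uw -supp_a us Ev leq_add2l => vw; congr (_ + _)%N; apply/eqP; rewrite eqn_leq vw.
Qed.

End Rectangle.

Theorem theorem4p8 (n : nat) (a : n.-tuple nat)
  (ha : forall i j : 'I_n,
    tnth a i != 0%N -> tnth a j != 0%N -> tnth a i = tnth a j) :
  lascoux a = \sum_(D in KKD a) wt_beta D.
Proof.
rewrite lascoux_rows_gf // -diagram_gf -skyline_sky //.
by apply: eq_bigl => D; rewrite inE.
Qed.
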